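(* Let $S$ be a $\pi$-regular ordered semigroup. The following conditions are equivalent: (1) $S$ is right $\pi$-inverse; (2) for every $a\in S$ there is $m\in\mathbb{N}$ such that for all $a',a''$, $a',a''\in V_\leq(a^m)$ implies $a'\,\mathcal{R}\,a''$; (3) for all $e,f\in E_\leq(S)$ there is $n\in\mathbb{N}$ such that $(ef)^n\in(fSf]$; (4) for all $e,f\in E_\leq(S)$, $((ef)^nS]\subseteq(eS]\cap(fS]$ for some $n\in\mathbb{N}$; (5) for every $e\in E_\leq(S)$ there is $m\in\mathbb{N}$ such that for all $x\in S$ and all $x'\in V_\leq(x^m)$, $x^m\in(Se]$ implies $x'\in(eS]$.
   Context: An ordered semigroup $(S,\cdot,\leq)$ is a (nonempty) semigroup with a partial order such that $a\leq b$ implies $xa\leq xb$ and $ax\leq bx$ for all $a,b,x\in S$. $\mathbb{N}$ denotes the positive integers. For $A\subseteq S$, $(A]=\{x\in S: x\leq a \text{ for some } a\in A\}$. $S$ is $\pi$-regular if for every $a\in S$ there is $m\in\mathbb{N}$ with $a^m\in(a^mSa^m]$. $E_\leq(S)=\{e\in S: e\leq e^2\}$ is the set of ordered idempotents. $V_\leq(a)=\{b\in S: a\leq aba \text{ and } b\leq bab\}$ is the set of ordered inverses of $a$. $R(a)=(\{a\}\cup aS]$, and $a\,\mathcal{R}\,b$ iff $R(a)=R(b)$. A $\pi$-regular ordered semigroup $S$ is right $\pi$-inverse if for every $a\in S$ there is $m\in\mathbb{N}$ such that $(Sa^m]$ is generated by an $\mathcal{R}$-unique ordered idempotent, i.e.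 there is $e\in E_\leq(S)$ with $(Sa^m]=(Se]$, and every $f\in E_\leq(S)$ with $(Sa^m]=(Sf]$ satisfies $e\,\mathcal{R}\,f$. *)

(* Defs.v *)
From HB Require Import structures.
From mathcomp Require Import all_boot all_order.
From mathcomp Require Import boolp classical_sets.

Set Implicit Arguments.
Unset Strict Implicit.
Unset Printing Implicit Defensive.

Import Order.Theory.
Local Open Scope classical_set_scope.
Local Open Scope order_scope.
Local Open Scope group_scope.

HB.mixin Record isOrderedSemigroup (d : Order.disp_t) S
    of Semigroup S & Order.POrder d S := {
  lemul2l : forall x a b : S, a <= b -> x * a <= x * b;
  lemul2r : forall x a b : S, a <= b -> a * x <= b * x
}.

(* The Pointed component expresses that S is nonempty. *)
#[short(type="orderedSemigroupType")]
HB.structure Definition OrderedSemigroup (d : Order.disp_t) :=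
  { S of isOrderedSemigroup d S & Semigroup S & Order.POrder d S & Pointed S }.

Section OrderedSemigroupDefs.
Context {d : Order.disp_t} {S : orderedSemigroupType d}.
Implicit Types a b e : S.

(* The n-th power for n > 0; S need not have a unit, so the value a at n = 0
   is junk and every use below assumes 0 < n. *)
Definition spow a (n : nat) : S := iterop n *%g a a.

(* The library's [down A] is the set written (A] in the literature. *)

Definition left_mul a : set S := down [set s * a | s in [set: S]].

Definition right_mul a : set S := down [set a * s | s in [set: S]].

Definition sandwich a : set S := down [set a * s * a | s in [set: S]].

Definition ordered_idempotent : set S := [set e | e <= e * e].

Definition ordered_inverse a : set S :=
  [set b | a <= a * b * a /\ b <= b * a * b].

Definition right_ideal a : set S :=
  down ([set a] `|` [set a * s | s in [set: S]]).

Definition greenR a b : Prop := right_ideal a = right_ideal b.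

End OrderedSemigroupDefs.

Definition pi_regular (d : Order.disp_t) (S : orderedSemigroupType d) : Prop :=
  forall a : S, exists m : nat, (0 < m)%N /\ sandwich (spow a m) (spow a m).

Definition right_pi_inverse (d : Order.disp_t) (S : orderedSemigroupType d) :
    Prop :=
  pi_regular S /\
  forall a : S, exists m : nat, (0 < m)%N /\
    exists e : S, [/\ ordered_idempotent e,
      left_mul (spow a m) = left_mul e &
      forall f : S, ordered_idempotent f ->
        left_mul (spow a m) = left_mul f -> greenR e f].

(* Main.v *)
(** Everything reduces to a cancellation property of ordered idempotents: if
    [k] and [p] generate the same left ideal, then [k] lies in [(pS]].
    (1), (2) and (5) are reformulations of it; for (2) one first enlarges [k]
    and [p] to ordered idempotents [g = k s p] and [q = p t g] that absorb each
    other on the right, hence are both ordered inverses of every power of [g].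
    To obtain (3), take a regular power [a = (ef)^n], write [a = e v] with [v]
    in [(fS]] and let [x] be an ordered inverse of [a]; then [p = v x e] and
    [k = e p] are ordered idempotents generating the same left ideal, so [k],
    and with it [a <= k a], lies in [(fS]]. *)

Require Import Defs.
From mathcomp Require Import all_boot all_order.
From mathcomp Require Import boolp classical_sets.

Set Implicit Arguments.
Unset Strict Implicit.
Unset Printing Implicit Defensive.

Import Order.Theory.
Local Open Scope classical_set_scope.
Local Open Scope order_scope.
Local Open Scope group_scope.

Section OrderedSemigroupTheory.
Context {d : Order.disp_t} {S : orderedSemigroupType d}.
Implicit Types a b c e f g k p s t u v x y : S.

(** * Principal one-sided ideals and Green's relation R *)

Lemma lemul a b c e : a <= b -> c <= e -> a * c <= b * e.
Proof.
by move=> ab ce; apply: le_trans (lemul2r _ _ _ ab) (lemul2l _ _ _ ce).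
Qed.

Lemma left_mulP a x : left_mul a x <-> exists s, x <= s * a.
Proof.
split=> [[_ [[s _ <-] le_x]]|[s le_x]]; first by exists s.
by exists (s * a); split=> //; exists s.
Qed.

Lemma right_mulP a x : right_mul a x <-> exists s, x <= a * s.
Proof.
split=> [[_ [[s _ <-] le_x]]|[s le_x]]; first by exists s.
by exists (a * s); split=> //; exists s.
Qed.

Lemma sandwichP a x : sandwich a x <-> exists s, x <= a * s * a.
Proof.
split=> [[_ [[s _ <-] le_x]]|[s le_x]]; first by exists s.
by exists (a * s * a); split=> //; exists s.
Qed.

Lemma right_idealP a x :
  right_ideal a x <-> x <= a \/ exists s, x <= a * s.
Proof.
split=> [[_ [[->|[s _ <-]] le_x]]|[le_x|[s le_x]]].
- by left.
- by right; exists s.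
- by exists a; split=> //; left.
- by exists (a * s); split=> //; right; exists s.
Qed.

Lemma le_right_mul a x y : x <= y -> right_mul a y -> right_mul a x.
Proof.
by move=> xy /right_mulP[s ys]; apply/right_mulP; exists s; apply: le_trans ys.
Qed.

Lemma right_mulMr a x y : right_mul a x -> right_mul a (x * y).
Proof.
move=> /right_mulP[s xs]; apply/right_mulP; exists (s * y).
by rewrite mulgA; apply: lemul2r.
Qed.

Lemma right_mul_trans a b x : right_mul a b -> right_mul b x -> right_mul a x.
Proof.
by move=> ab /right_mulP[s xs]; apply: le_right_mul xs _; apply: right_mulMr.
Qed.

Lemma left_mul_sub a b : left_mul a b -> left_mul b `<=` left_mul a.
Proof.
move=> /left_mulP[s bs] x /left_mulP[t xt]; apply/left_mulP; exists (t * s).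
by apply: (le_trans xt); rewrite -mulgA; apply: lemul2l.
Qed.

Lemma left_mul_eq a b : left_mul a b -> left_mul b a -> left_mul a = left_mul b.
Proof.
by move=> ab ba; apply/seteqP; split;
  [exact: left_mul_sub ba|exact: left_mul_sub ab].
Qed.

Lemma greenRP a b : right_mul a b -> right_mul b a -> greenR a b.
Proof.
have sub x y : right_mul x y -> right_ideal y `<=` right_ideal x.
  move=> xy z /right_idealP yz; apply/right_idealP; right; apply/right_mulP.
  case: yz => [zy|/right_mulP yz]; first exact: le_right_mul zy xy.
  exact: right_mul_trans yz.
by move=> ab ba; apply/seteqP; split; [exact: sub ba|exact: sub ab].
Qed.

Lemma idem_right_mul e : ordered_idempotent e -> right_mul e e.
Proof. by move=> ee; apply/right_mulP; exists e. Qed.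

Lemma idem_left_mul e : ordered_idempotent e -> left_mul e e.
Proof. by move=> ee; apply/left_mulP; exists e. Qed.

(** For an ordered idempotent, [e <= e * e] already puts the generator adjoined in [right_ideal]
    inside [(eS]]. *)
Lemma greenR_idem a e :
  ordered_idempotent e -> greenR e a -> right_mul e a.
Proof.
move=> ee ea; have : right_ideal e a.
  by rewrite ea; apply/right_idealP; left.
case/right_idealP=> [ae|/right_mulP//].
exact: le_right_mul ae (idem_right_mul ee).
Qed.

(** * Powers, ordered inverses and ordered idempotents *)

Lemma spowS a n : spow a n.+2 = a * spow a n.+1.
Proof. by rewrite /spow !iteropS. Qed.

Lemma spowSr a n : spow a n.+2 = spow a n.+1 * a.
Proof. by elim: n => // n IHn; rewrite spowS {1}IHn mulgA -spowS. Qed.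

Lemma le_spow a b n : a <= b -> spow a n.+1 <= spow b n.+1.
Proof. by move=> ab; elim: n => // n IHn; rewrite !spowS; apply: lemul. Qed.

Lemma idem_le_spow e n : ordered_idempotent e -> e <= spow e n.+1.
Proof.
move=> ee; elim: n => // n IHn; rewrite spowS.
by apply: (le_trans ee); apply: lemul2l.
Qed.

Lemma left_mul_spow a n e : left_mul e a -> left_mul e (spow a n.+1).
Proof.
case: n => // n ea; apply: (left_mul_sub ea).
by apply/left_mulP; exists (spow a n.+1); rewrite spowSr.
Qed.

Lemma spow_le_mulr a b n : a <= a * b -> spow a n.+1 <= spow a n.+1 * b.
Proof. by case: n => // n ab; rewrite spowSr -mulgA; apply: lemul2l. Qed.

(** The last factor of the power absorbs [f], and [f] absorbs the whole power because [e] lies below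
    it. The exponent is arbitrary since condition (2) gives no control over it. *)
Lemma absorbing_inverse_spow e f n :
    ordered_idempotent e -> ordered_idempotent f -> e <= e * f -> f <= f * e ->
  ordered_inverse (spow e n.+1) f.
Proof.
move=> ee ff ef fe; have fen : f <= f * spow e n.+1.
  by apply: (le_trans fe); apply: lemul2l; apply: idem_le_spow.
split; last by apply: (le_trans ff); apply: lemul2r.
apply: le_trans (spow_le_mulr _ ef) _.
by rewrite -mulgA; apply: lemul2l.
Qed.

Lemma idem_inverse_spow e n :
  ordered_idempotent e -> ordered_inverse (spow e n.+1) e.
Proof. by move=> ee; apply: absorbing_inverse_spow. Qed.

Lemma regular_inverse a : sandwich a a -> exists x, ordered_inverse a x.
Proof.
case/sandwichP=> s asa; exists (s * a * s); split.
  by apply: (le_trans asa); rewrite !mulgA; do 2 apply: lemul2r.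
have -> : s * a * s * a * (s * a * s) = s * (a * s * a * s * a) * s.
  by rewrite !mulgA.
apply/lemul2r/lemul2l; apply: (le_trans asa).
by do 2 apply: lemul2r.
Qed.

(** The product [s * p] need not be an ordered idempotent; the leading [k] makes it one, since
    [k <= k * k <= (k * s * p) * k]. *)
Lemma idem_enlarge k s p :
    ordered_idempotent k -> ordered_idempotent p -> k <= s * p ->
  [/\ k <= k * s * p, ordered_idempotent (k * s * p)
    & k * s * p <= k * s * p * p].
Proof.
move=> kk pp ksp; have kg : k <= k * s * p.
  by apply: (le_trans kk); rewrite -mulgA; apply: lemul2l.
split=> //; last by rewrite -[leRHS]mulgA; apply: lemul2l.
rewrite /ordered_idempotent /= [leRHS]mulgA; apply: lemul2r.
rewrite [leRHS]mulgA; apply: lemul2r.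
by apply: (le_trans kk); apply: lemul2r.
Qed.

(** The product [x * a] links the two sides: it generates the same left ideal as [a] and the same
    right ideal as [x]. *)
Lemma inverse_idem a x : ordered_inverse a x -> ordered_idempotent (x * a).
Proof.
case=> axa _; rewrite /ordered_idempotent /= -mulgA.
by apply: lemul2l; rewrite mulgA.
Qed.

Lemma inverse_left_mul a x : ordered_inverse a x -> left_mul (x * a) = left_mul a.
Proof.
case=> axa _; apply: left_mul_eq; apply/left_mulP; last by exists x.
by exists a; rewrite mulgA.
Qed.

Lemma inverse_right_mul a x : ordered_inverse a x -> right_mul (x * a) x.
Proof. by case=> _ xax; apply/right_mulP; exists x. Qed.

Lemma spow_mul_decomp e f n : ordered_idempotent f ->
  exists v, spow (e * f) n.+1 = e * v /\ right_mul f v.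
Proof.
(* Without a unit, exponent one forces [v = f], and [f <= f * f] is what puts it in [(fS]]. *)
move=> ff; case: n => [|n]; first by exists f; split=> //; apply: idem_right_mul.
exists (f * spow (e * f) n.+1); split; first by rewrite spowS mulgA.
by apply/right_mulP; exists (spow (e * f) n.+1).
Qed.

Lemma spow_mul_le_mulr e f n : ordered_idempotent f ->
  spow (e * f) n.+1 <= spow (e * f) n.+1 * f.
Proof.
by move=> ff; apply: spow_le_mulr; rewrite -mulgA; apply: lemul2l.
Qed.

End OrderedSemigroupTheory.

(** By symmetry in [k] and [p], this makes ordered idempotents with the same left ideal
    R-related. *)
Definition idempotent_cancellation (d : Order.disp_t)
    (S : orderedSemigroupType d) : Prop :=
  forall k p : S, ordered_idempotent k -> ordered_idempotent p ->
    left_mul k = left_mul p -> right_mul p k.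

Section RightPiInverse.
Context {d : Order.disp_t} {S : orderedSemigroupType d}.

Lemma right_pi_inverse_cancellation :
  right_pi_inverse S -> idempotent_cancellation S.
Proof.
case=> _ rpi k p kk pp kp; have [[|m] [// _ [e [ee km_e uniq_e]]]] := rpi k.
(* Both [k] and [p] generate the left ideal of this power of [k], so both are R-related to [e]. *)
have kmk : left_mul (spow k m.+1) = left_mul k.
  apply: left_mul_eq; last exact/left_mul_spow/idem_left_mul.
  apply/left_mulP; exists k; apply: (le_trans kk).
  exact/lemul2l/idem_le_spow.
have ek := uniq_e k kk kmk; have ep := uniq_e p pp (etrans kmk kp).
by apply: greenR_idem pp _; rewrite /greenR -ep.
Qed.

Lemma cancellation_inverses_greenR : idempotent_cancellation S ->
  forall a x y : S, ordered_inverse a x -> ordered_inverse a y -> greenR x y.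
Proof.
move=> canc.
have sub (a x y : S) : ordered_inverse a x -> ordered_inverse a y -> right_mul x y.
  move=> ax ay; have xya : right_mul (x * a) (y * a).
    apply: canc; [exact: inverse_idem ay|exact: inverse_idem ax|].
    by rewrite !inverse_left_mul.
  have xx : right_mul x (x * a) by apply/right_mulP; exists a.
  exact: right_mul_trans xx (right_mul_trans xya (inverse_right_mul ay)).
by move=> a x y ax ay; apply: greenRP; apply: (sub a).
Qed.

Lemma inverses_greenR_cancellation :
    (forall a : S, exists m : nat, (0 < m)%N /\
      forall x y : S, ordered_inverse (spow a m) x ->
        ordered_inverse (spow a m) y -> greenR x y) ->
  idempotent_cancellation S.
Proof.
move=> invR k p kk pp kp.
have /left_mulP[s ksp] : left_mul p k by rewrite -kp; apply: idem_left_mul.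
have [] := idem_enlarge kk pp ksp; set g := k * s * p => kg gg gp.
have /left_mulP[t ptk] : left_mul k p by rewrite kp; apply: idem_left_mul.
have ptg : p <= t * g by apply: (le_trans ptk); apply: lemul2l.
(* Enlarging towards [g] rather than [k] gives [q <= q * g]; the other absorption is
   [g <= g * p <= g * q]. *)
have [] := idem_enlarge pp gg ptg; set q := p * t * g => pq qq qg.
have gq : g <= g * q by apply: (le_trans gp); apply: lemul2l.
have [[|m] [// _ invg]] := invR g.
have qRg : greenR q g.
  by apply: invg; [apply: absorbing_inverse_spow|apply: idem_inverse_spow].
have pq_right : right_mul p q.
  by apply/right_mulP; exists (t * g); rewrite mulgA.
apply: le_right_mul kg _; apply: right_mul_trans pq_right _.
exact: greenR_idem qRg.
Qed.

Lemma cancellation_sandwich : pi_regular S -> idempotent_cancellation S ->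
  forall e f : S, ordered_idempotent e -> ordered_idempotent f ->
    exists n : nat, (0 < n)%N /\ sandwich f (spow (e * f) n).
Proof.
move=> reg canc e f ee ff.
have [[|n] [// _ /regular_inverse[x [axa xax]]]] := reg (e * f).
have [v [av fv]] := spow_mul_decomp e n ff.
have af := spow_mul_le_mulr e n ff.
exists n.+1; split=> //; move: (spow _ _) => a in axa xax av af *.
have aea : a <= e * a by rewrite av mulgA; apply: lemul2r.
set p := v * x * e; set k := e * p.
have ke : k = a * x * e by rewrite /k /p !mulgA -av.
have pp : ordered_idempotent p.
  rewrite /ordered_idempotent /= /p.
  have -> : v * x * e * (v * x * e) = v * (x * a * x) * e by rewrite av !mulgA.
  by apply: lemul2r; apply: lemul2l.
have kk : ordered_idempotent k.
  rewrite /ordered_idempotent /= ke [leRHS]mulgA; apply: lemul2r.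
  rewrite [leRHS]mulgA; apply: lemul2r.
  by apply: (le_trans axa); rewrite -[leRHS]mulgA; apply: lemul2l.
have kp : left_mul k = left_mul p.
  apply: left_mul_eq; apply/left_mulP; last by exists e.
  exists (v * x); rewrite ke /p.
  have -> : v * x * (a * x * e) = v * (x * a * x) * e by rewrite !mulgA.
  by apply: lemul2r; apply: lemul2l.
have fp : right_mul f p by do 2 apply: right_mulMr.
have fk := right_mul_trans fp (canc k p kk pp kp).
(* Here [k * a = a * x * (e * a)], and [e * a] dominates [a]. *)
have ka : a <= k * a.
  apply: (le_trans axa).
  by rewrite ke -[leRHS]mulgA; apply: lemul2l.
have /right_mulP[s afs] := le_right_mul ka (right_mulMr a fk).
by apply/sandwichP; exists s; apply: (le_trans af); apply: lemul2r.
Qed.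

End RightPiInverse.

Theorem theorem3p2 (d : Order.disp_t) (S : orderedSemigroupType d)
    (S_pi_regular : pi_regular S) :
  [<->
    right_pi_inverse S;
    forall a : S, exists m : nat, (0 < m)%N /\
      forall a' a'' : S, ordered_inverse (spow a m) a' ->
        ordered_inverse (spow a m) a'' -> greenR a' a'';
    forall e f : S, ordered_idempotent e -> ordered_idempotent f ->
      exists n : nat, (0 < n)%N /\ sandwich f (spow (e * f) n);
    forall e f : S, ordered_idempotent e -> ordered_idempotent f ->
      exists n : nat, (0 < n)%N /\
        right_mul (spow (e * f) n) `<=` right_mul e `&` right_mul f;
    forall e : S, ordered_idempotent e ->
      exists m : nat, (0 < m)%N /\
        forall x x' : S, ordered_inverse (spow x m) x' ->
          left_mul e (spow x m) -> right_mul e x' ].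
Proof.
tfae.
- move=> /right_pi_inverse_cancellation canc a; exists 1%N; split=> // x y.
  exact: cancellation_inverses_greenR.
- move=> invR; apply: cancellation_sandwich => //.
  exact: inverses_greenR_cancellation.
- move=> sand e f ee ff; have [[|n] [// _ /sandwichP[s efs]]] := sand e f ee ff.
  exists n.+1; split=> // x efx; split; apply: right_mul_trans efx.
    have [v [-> _]] := spow_mul_decomp e n ff.
    by apply/right_mulP; exists v.
  by apply/right_mulP; exists (s * f); rewrite mulgA.
(* Since [y] lies in [(fS]] for [f = y * x], it suffices to put [f] in [(eS]]. Condition (4) is
   applied to [e] and an ordered idempotent [g] above [f] with [g <= g * e]. *)
- move=> sub e ee; exists 1%N; split=> // x y xy /left_mulP[s xse].
  have ff := inverse_idem xy; have fx := inverse_right_mul xy.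
  set f := y * x in ff fx.
  have fte : f <= y * s * e by rewrite -mulgA; apply: lemul2l.
  have [] := idem_enlarge ff ee fte; set g := f * _ * e => fg gg ge.
  have [[|n] [// _ subn]] := sub g e gg ee.
  (* One factor beyond exponent [n.+1] is needed to place [f] in the right ideal
     [((ge)^(n+1) S]]. *)
  have fn : f <= spow (g * e) n.+1 * (g * e).
    rewrite -spowSr; apply: le_trans (idem_le_spow n.+1 ff) _.
    by apply: le_spow; apply: le_trans ge.
  have [_ ef] : (right_mul g `&` right_mul e) f.
    by apply: subn; apply/right_mulP; exists (g * e).
  exact: right_mul_trans fx.
- move=> inv; split=> // a; have [m [m0 reg]] := S_pi_regular a.
  have [x ax] := regular_inverse reg.
  exists m; split=> //; exists (x * spow a m).
  have ee := inverse_idem ax; have ea := inverse_left_mul ax.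
  (* Cancellation again: [g] is an ordered inverse of its own powers, and these lie in [(Sf]], so
     (5) for [f] applies. *)
  have canc (f g : S) : ordered_idempotent f -> ordered_idempotent g ->
      left_mul f = left_mul g -> right_mul f g.
    move=> ff gg fg; have [[|n] [// _ invf]] := inv f ff.
    apply: (invf g); first exact: idem_inverse_spow.
    by apply: left_mul_spow; rewrite fg; apply: idem_left_mul.
  split=> // f ff af; have ef := etrans ea af.
  by apply: greenRP; apply: canc.
Qed.
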